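(* Let $X$ be a smooth complex projective curve, $D=\{x_1,\dots,x_s\}$ a reduced effective divisor on $X$, $G$ a connected complex reductive group, and $\boldsymbol\theta=\{\theta_j\}_{j=1}^s$ a collection of weights at the points $x_j$. The level group $G_D$ acts freely on the regularly stable moduli space $\mathcal{U}^{rs}(X,\mathcal{G}_{\boldsymbol\theta})$ of parahoric $\mathcal{G}_{\boldsymbol\theta}$-torsors over $X$ with $D$-level structure.
   Context: Parahoric setting. $T\subset G$ is a maximal torus with root system $\mathcal{R}$, root subgroups $U_r$; $Z=Z(G)$ is the center; $R=\mathbb{C}[[z]]$, $K=\mathbb{C}((z))$. For a (rational) weight $\theta\in Y(T)\otimes\mathbb{Q}$, $r(\theta)=\langle\theta,r\rangle$, $m_r(\theta)=\lceil -r(\theta)\rceil$, $G_\theta=\langle T(R),U_r(z^{m_r(\theta)}R),r\in\mathcal{R}\rangle\subset G(K)$; $G_\theta^+$ is its pro-unipotent radical and $G_\theta/G_\theta^+\cong L_\theta=\langle T(\mathbb{C}),U_r(\mathbb{C}):r(\theta)\in\mathbb{Z}\rangle$. $\mathcal{G}_{\boldsymbol\theta}$ is the group scheme on $X$ glued from $G\times(X\setminus D)$ and $G_{\theta_x}$ on the formal discs $\mathbb{D}_x=\mathrm{Spec}\,\widehat{\mathcal{O}}_{X,x}$. A parahoric $\mathcal{G}_{\boldsymbol\theta}$-torsor $\mathcal{E}$ is one trivial over the generic point. A $D$-level structure on $\mathcal{E}$ is a choice of section $\eta_x:\mathbb{D}_x\to G_{\theta_x}/G_{\theta_x}^+$ for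 each $x\in D$. Pairs $(\mathcal{E}_1,\eta_1),(\mathcal{E}_2,\eta_2)$ are equivalent if there is an isomorphism $h:\mathcal{E}_1\to\mathcal{E}_2$ with $h\circ\eta_{1,x}=\eta_{2,x}$. Stability. For a parabolic $P\subset G$ with root set $\mathcal{R}_P$, $\mathcal{P}_{\boldsymbol\theta}\subset\mathcal{G}_{\boldsymbol\theta}$ is glued from $P\times(X\setminus D)$ and $\langle T(R),U_r(z^{m_r(\theta_x)}R),r\in\mathcal{R}_P\rangle$ on $\mathbb{D}_x$. Characters $\kappa$ of $\mathcal{P}_{\boldsymbol\theta}$ correspond to characters $\chi$ of $P$, $\langle\theta_x,\kappa\rangle:=\langle\theta_x,\chi\rangle$. $\mathcal{E}$ is stable if for every proper parabolic $P$, every reduction $\varsigma:X\to\mathcal{E}/\mathcal{P}_{\boldsymbol\theta}$ (with $\mathcal{P}_{\boldsymbol\theta}$-torsor $\mathcal{E}_\varsigma$) and every nontrivial anti-dominant character $\kappa$, $\deg(\kappa_*\mathcal{E}_\varsigma)+\sum_{x\in D}\langle\theta_x,\kappa\rangle>0$. A pair $(\mathcal{E},\eta)$ is stable if $\mathcal{E}$ is; $\mathcal{U}(X,\mathcal{G}_{\boldsymbol\theta})$ is the moduli space of stable pairs. A stable $\mathcal{E}$ is regularly stable if $\mathrm{Aut}(\mathcal{E})=Z(G)$; $\mathcal{U}^{rs}(X,\mathcal{G}_{\boldsymbol\theta})\subset\mathcal{U}(X,\mathcal{G}_{\boldsymbol\theta})$ is the open subvariety of pairs with $\mathcal{E}$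 regularly stable. Level group. $G_D=(L_{\theta_1}\times\cdots\times L_{\theta_s})/Z$, with $Z$ embedded diagonally. It acts by modifying the level structures: $(g_1,\dots,g_s)$ multiplies $\eta_{x_j}$ on the left by $g_j\in L_{\theta_j}\cong G_{\theta_j}/G_{\theta_j}^+$. *)

(* Defs.v *)
From HB Require Import structures.
From mathcomp Require Import all_boot all_order all_algebra.
From mathcomp Require Import boolp classical_sets cardinality fsbigop reals.
From mathcomp Require Import complex.
From mathcomp Require Import mpoly.

Set Implicit Arguments.
Unset Strict Implicit.
Unset Printing Implicit Defensive.

Import Order.TTheory GRing.Theory Num.Theory.
Local Open Scope classical_set_scope.
Local Open Scope ring_scope.

Record fps (C : Type) := Fps { fcoef : nat -> C }.

HB.instance Definition _ (C : Type) := gen_eqMixin (fps C).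
HB.instance Definition _ (C : Type) := gen_choiceMixin (fps C).

Section PowerSeries.
Variable C : fieldType.
Local Notation ps := (fps C).
Implicit Types f g h : ps.

Lemma fpsP f g : (forall n, fcoef f n = fcoef g n) -> f = g.
Proof. by case: f => f; case: g => g /= fg; congr Fps; apply/funext. Qed.

Definition fps_add f g : ps := Fps (fun n => fcoef f n + fcoef g n).
Definition fps_opp f : ps := Fps (fun n => - fcoef f n).
Definition fps_const (c : C) : ps := Fps (fun n => c *+ (n == 0%N)).
Definition fps_z : ps := Fps (fun n => (n == 1%N)%:R).
Definition fps_mul f g : ps :=
  Fps (fun n => \sum_(i < n.+1) fcoef f i * fcoef g (n - i)%N).

Fact fps_addA : associative fps_add.
Proof. by move=> f g h; apply: fpsP => n /=; rewrite addrA. Qed.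
Fact fps_addC : commutative fps_add.
Proof. by move=> f g; apply: fpsP => n /=; rewrite addrC. Qed.
Fact fps_add0 : left_id (fps_const 0) fps_add.
Proof. by move=> f; apply: fpsP => n /=; rewrite mul0rn add0r. Qed.
Fact fps_addN : left_inverse (fps_const 0) fps_opp fps_add.
Proof. by move=> f; apply: fpsP => n /=; rewrite mul0rn addNr. Qed.

HB.instance Definition _ :=
  GRing.isZmodule.Build ps fps_addA fps_addC fps_add0 fps_addN.

Let tr N f : {poly C} := \poly_(i < N) fcoef f i.

Let trE N f n : (n < N)%N -> (tr N f)`_n = fcoef f n.
Proof. by move=> nN; rewrite coef_poly nN. Qed.

Let tr_mul N f g n : (n < N)%N -> fcoef (fps_mul f g) n = (tr N f * tr N g)`_n.
Proof.
move=> nN; rewrite coefM; apply: eq_bigr => i _.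
by rewrite !trE // (leq_ltn_trans _ nN) // ?leq_subr // -ltnS.
Qed.

Fact fps_mulA : associative fps_mul.
Proof.
move=> f g h; apply: fpsP => n.
transitivity ((tr n.+1 f * tr n.+1 g * tr n.+1 h)`_n).
  rewrite -mulrA coefM; apply: eq_bigr => i _.
  by rewrite trE // (@tr_mul n.+1) // ltnS leq_subr.
rewrite coefM; apply: eq_bigr => i _.
by rewrite (@tr_mul n.+1) // trE // ltnS leq_subr.
Qed.

Fact fps_mulC : commutative fps_mul.
Proof.
by move=> f g; apply: fpsP => n; rewrite !(@tr_mul n.+1) // mulrC.
Qed.

Fact fps_mul1 : left_id (fps_const 1) fps_mul.
Proof.
move=> f; apply: fpsP => n /=; rewrite big_ord_recl /= subn0 mul1r.
by rewrite big1 ?addr0 // => i _; rewrite mul0r.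
Qed.

Fact fps_mulD : left_distributive fps_mul fps_add.
Proof.
move=> f g h; apply: fpsP => n /=; rewrite -big_split.
by apply: eq_bigr => i _; rewrite mulrDl.
Qed.

Fact fps_1neq0 : fps_const 1 != 0.
Proof.
by apply/eqP => /(congr1 (fun f => fcoef f 0)) /= /eqP; rewrite oner_eq0.
Qed.

HB.instance Definition _ := GRing.Zmodule_isComNzRing.Build ps
  fps_mulA fps_mulC fps_mul1 fps_mulD fps_1neq0.

Definition fps_unit : {pred ps} := fun f => `[< exists g, g * f = 1 >].
Definition fps_inv f : ps :=
  match pselect (exists g, g * f = 1) with
  | left ex => projT1 (cid ex)
  | right _ => f
  end.

Fact fps_mulV : {in fps_unit, left_inverse 1 fps_inv *%R}.
Proof.
move=> f; rewrite unfold_in /fps_inv => /asboolP.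
by case: pselect => // ex _; case: cid.
Qed.
Fact fps_unitPl f g : g * f = 1 -> fps_unit f.
Proof. by move=> gf; apply/asboolP; exists g. Qed.
Fact fps_inv_out : {in [predC fps_unit], fps_inv =1 id}.
Proof.
move=> f; rewrite inE unfold_in /fps_inv => /asboolP.
by case: pselect.
Qed.

HB.instance Definition _ := GRing.ComNzRing_hasMulInverse.Build ps
  fps_mulV fps_unitPl fps_inv_out.

Let fps_low f : f != 0 ->
  exists n, fcoef f n != 0 /\ forall m, (m < n)%N -> fcoef f m = 0.
Proof.
move=> f0; have ex : exists n, fcoef f n != 0.
  apply: contrapT => nex; case/negP: f0; apply/eqP; apply: fpsP => n /=.
  rewrite mul0rn; apply: contrapT => /eqP fn; apply: nex.
  by exists n.
exists (ex_minn ex); case: ex_minnP => n n0 min; split=> // m mn.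
by apply/eqP; apply: contraTT mn => /min; rewrite -leqNgt.
Qed.

Fact fps_idomain : GRing.integral_domain_axiom ps.
Proof.
move=> f g fg; apply: contraT; rewrite negb_or.
case/andP=> /fps_low [a [fa la]] /fps_low [b [gb lb]].
have : fcoef (f * g) (a + b) = 0 by rewrite fg /= mul0rn.
have ab : (a < (a + b).+1)%N by rewrite ltnS leq_addr.
rewrite /= (bigD1 (Ordinal ab)) //= big1 ?addr0 => [|i ia].
  by rewrite addKn => /eqP; rewrite mulf_eq0 (negPf fa) (negPf gb).
case: (ltngtP i a) => [ltia|ltai|eqia].
- by rewrite la // mul0r.
- rewrite lb ?mulr0 //.
  have iab : (i <= a + b)%N by rewrite -ltnS.
  by rewrite ltn_subLR // ltn_add2r.
- by case/eqP: ia; apply: val_inj.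
Qed.

HB.instance Definition _ := GRing.ComUnitRing_isIntegral.Build ps fps_idomain.

End PowerSeries.

Section Laurent.
Variable C : fieldType.

Definition laurent : fieldType := {fraction (fps C)}.

Definition of_fps (a : fps C) : laurent := FracField.tofrac a.
Definition laurent_const (c : C) : laurent := of_fps (fps_const c).
Definition laurent_z : laurent := of_fps (fps_z C).

(* the fractional ideal z^m C[[z]] *)
Definition zideal (m : int) : set laurent :=
  [set laurent_z ^ m * of_fps a | a in [set: fps C]].

Definition integral : set laurent := range of_fps.

(* z-adic valuation of a nonzero f; the value at 0 is irrelevant *)
Definition zval (f : laurent) : int :=
  xget 0 [set k | zideal k f /\ ~ zideal (k + 1) f].

Definition mx_zideal n (m : int) : set 'M[laurent]_n :=
  [set g | forall i j, zideal m (g i j)].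

(* GL_n(C[[z]]) inside GL_n(C((z))) *)
Definition GLintegral n : set 'M[laurent]_n :=
  [set g | [/\ g \in unitmx, mx_zideal 0 g & mx_zideal 0 (invmx g)]].

End Laurent.
Arguments laurent_const {C} c.
Arguments zideal {C} m.
Arguments integral {C}.
Arguments GLintegral {C n}.

Section MatrixGroups.
Variables (S : fieldType) (n : nat).
Implicit Types (A H : set 'M[S]_n).

Definition mx_subgroup H :=
  [/\ H `<=` [set g | g \in unitmx], H 1%:M,
      forall g h, H g -> H h -> H (g *m h) & forall g, H g -> H (invmx g)].

Definition mx_gen A : set 'M[S]_n :=
  [set g | forall H, mx_subgroup H -> A `<=` H -> H g].

Definition mx_derived H : set 'M[S]_n :=
  mx_gen [set g *m h *m invmx g *m invmx h | g in H & h in H].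

Definition mx_solvable H := exists k, iter k mx_derived H = [set 1%:M].

Definition mx_normal_in N H :=
  [/\ mx_subgroup N, N `<=` H &
      forall g h, H g -> N h -> N (g *m h *m invmx g)].

Definition mx_center H : set 'M[S]_n :=
  [set z | H z /\ forall g, H g -> z *m g = g *m z].

Definition lcoset (g : 'M[S]_n) A : set 'M[S]_n := [set g *m h | h in A].

End MatrixGroups.

Section AlgebraicGroups.
Variables (C : fieldType) (n : nat).
Implicit Types (A B H G T P : set 'M[C]_n).

(* regular functions on 'M_n are polynomials in the n * n entries *)
Definition mxeval (S : fieldType) (i : C -> S) (f : {mpoly C[n * n]})
  (g : 'M[S]_n) : S := mmap i (fun k => mxvec g 0 k) f.

Definition vanishing A : set {mpoly C[n * n]} :=
  [set f | forall a, A a -> mxeval idfun f a = 0].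

(* The S-points, for a field extension i : C -> S, of the Zariski closure of A
   in GL_n (with its reduced structure) *)
Definition points (S : fieldType) (i : C -> S) A : set 'M[S]_n :=
  [set g | g \in unitmx /\ forall f, vanishing A f -> mxeval i f g = 0].

Definition zariski_closed A := points idfun A = A.

Definition zariski_connected A :=
  forall B1 B2, zariski_closed B1 -> zariski_closed B2 ->
    A = B1 `|` B2 -> B1 `&` B2 = set0 -> B1 = set0 \/ B2 = set0.

Definition algebraic_group H := mx_subgroup H /\ zariski_closed H.

Definition connected_group H := algebraic_group H /\ zariski_connected H.

Definition unipotent (g : 'M[C]_n) := exists k, (g - 1%:M) ^+ k = 0.

(* trivial unipotent radical *)
Definition reductive G := algebraic_group G /\
  forall N, connected_group N -> mx_normal_in N G -> N `<=` unipotent ->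
    N = [set 1%:M].

Definition torus T := connected_group T /\
  exists2 g, g \in unitmx & forall t, T t -> is_diag_mx (g *m t *m invmx g).

Definition maximal_torus G T := [/\ torus T, T `<=` G &
  forall T', torus T' -> T' `<=` G -> T `<=` T' -> T' = T].

Definition borel G B :=
  [/\ connected_group B, mx_solvable B, B `<=` G &
      forall B', connected_group B' -> mx_solvable B' -> B' `<=` G ->
        B `<=` B' -> B' = B].

Definition parabolic G P :=
  [/\ algebraic_group P, P `<=` G & exists2 B, borel G B & B `<=` P].

(* (f, k) stands for the function f / det ^ k on GL_n *)
Definition regfun : Type := ({mpoly C[n * n]} * nat)%type.

Definition regeval (S : fieldType) (i : C -> S) (chi : regfun)
  (g : 'M[S]_n) : S := mxeval i chi.1 g / \det g ^+ chi.2.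

Local Notation "chi @ g" := (regeval idfun chi g) (at level 30).

Definition character H (chi : regfun) := chi @ 1%:M = 1 /\
  forall g h, H g -> H h -> chi @ (g *m h) = (chi @ g) * (chi @ h).

Definition nontrivial_on H (chi : regfun) := exists2 h, H h & chi @ h != 1.

(* (p, e) stands for the Laurent polynomial map t |-> t ^ - e * p(t) *)
Definition laurent_curve : Type := ('M[{poly C}]_n * nat)%type.

Definition curve_eval (lam : laurent_curve) (t : C) : 'M[C]_n :=
  t ^- lam.2 *: map_mx (fun p : {poly C} => p.[t]) lam.1.

Definition cocharacter T (lam : laurent_curve) :=
  (forall t, t != 0 -> T (curve_eval lam t)) /\
  (forall t u, t != 0 -> u != 0 ->
     curve_eval lam (t * u) = curve_eval lam t *m curve_eval lam u).

(* <lam, chi> is the integer k such that chi (lam t) = t ^ k *)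
Definition pairing (lam : laurent_curve) (chi : regfun) : int :=
  xget 0 [set k | forall t, t != 0 -> chi @ (curve_eval lam t) = t ^ k].

Definition lie_algebra G : set 'M[C]_n :=
  [set A | forall f, vanishing G f ->
     \sum_k mxvec A 0 k * mxeval idfun (mderiv k f) 1%:M = 0].

Definition is_root G T (r : regfun) :=
  [/\ character T r, nontrivial_on T r &
      exists A : 'M[C]_n, [/\ A != 0, lie_algebra G A &
        forall t, T t -> t *m A *m invmx t = (r @ t) *: A]].

Definition polymx_eval (S : fieldType) (i : C -> S) (u : 'M[{poly C}]_n)
  (c : S) : 'M[S]_n := map_mx (fun p : {poly C} => (map_poly i p).[c]) u.

(* u is an isomorphism of the additive group onto the root subgroup of the
   character rho of T *)
Definition root_hom G T (rho : 'M[C]_n -> C) (u : 'M[{poly C}]_n) :=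
  [/\ forall c, G (polymx_eval idfun u c),
      forall a b, polymx_eval idfun u (a + b) =
                  polymx_eval idfun u a *m polymx_eval idfun u b,
      injective (polymx_eval idfun u) &
      forall t c, T t -> t *m polymx_eval idfun u c *m invmx t =
                         polymx_eval idfun u (rho t * c)].

(* U_r(I) for an additive subgroup I of S *)
Definition root_subgroup G T (rho : 'M[C]_n -> C) (S : fieldType) (i : C -> S)
  (I : set S) : set 'M[S]_n :=
  [set g | exists2 u, root_hom G T rho u & exists2 c, I c &
     g = polymx_eval i u c].

Definition rootU G T (r : regfun) : set 'M[C]_n :=
  root_subgroup G T (regeval idfun r) idfun setT.

Definition roots_of G T P : set regfun :=
  [set r | is_root G T r /\ rootU G T r `<=` P].

(* the cocharacter of T in the SL_2 generated by U_r and U_-r with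
   <lam, r> = 2 *)
Definition coroot G T (r : regfun) (lam : laurent_curve) :=
  [/\ cocharacter T lam, pairing lam r = 2 &
      forall t, t != 0 ->
        mx_gen (rootU G T r `|`
                root_subgroup G T (fun g => (r @ g)^-1) idfun setT)
               (curve_eval lam t)].

(* Nonpositive combinations of fundamental weights; in particular these
   characters are trivial on the center *)
Definition antidominant G T P (chi : regfun) :=
  [/\ character P chi,
      forall r lam, roots_of G T P r -> coroot G T r lam ->
        pairing lam chi <= 0 &
      forall z, mx_center G z -> chi @ z = 1].

(* an element lam (x) 1/d of Y(T) (x) Q *)
Record weight := Weight { wnum : laurent_curve; wden : nat }.

Definition rational_weight T (theta : weight) :=
  cocharacter T (wnum theta) /\ (0 < wden theta)%N.

Definition weight_pairing (theta : weight) (chi : regfun) : rat :=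
  (pairing (wnum theta) chi)%:~R / (wden theta)%:R.

Definition mlevel (theta : weight) (r : regfun) : int :=
  Num.ceil (- weight_pairing theta r).

End AlgebraicGroups.

Section Parahoric.
Variables (C : fieldType) (n : nat).
Variables (G T : set 'M[C]_n).
Local Notation K := (laurent C).

Definition Gintegral (H : set 'M[C]_n) : set 'M[K]_n :=
  points laurent_const H `&` GLintegral.

Definition parahoric_roots (theta : weight C n) (rs : set (regfun C n)) :
  set 'M[K]_n :=
  mx_gen (Gintegral T `|`
    [set g | exists2 r, rs r &
       root_subgroup G T (regeval idfun r) laurent_const
         (zideal (mlevel theta r)) g]).

Definition parahoric (theta : weight C n) : set 'M[K]_n :=
  parahoric_roots theta (is_root G T).

Definition topologically_unipotent (g : 'M[K]_n) :=
  forall m : nat, exists k0, forall k, (k0 <= k)%N ->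
    mx_zideal m%:Z ((g - 1%:M) ^+ k).

(* The largest normal pro-unipotent subgroup of G_theta: an element acts
   unipotently on all the algebraic quotients of G_theta iff it is topologically
   unipotent in GL_n(C((z))) *)
Definition prounipotent_radical (theta : weight C n) : set 'M[K]_n :=
  [set g | exists N, [/\ mx_normal_in N (parahoric theta),
                         N `<=` topologically_unipotent & N g]].

Definition levi (theta : weight C n) : set 'M[C]_n :=
  mx_gen (T `|` [set g | exists r,
    [/\ is_root G T r, weight_pairing theta r \is a Num.int & rootU G T r g]]).

(* res : G_theta -> L_theta is the surjection with kernel G_theta^+ that induces
   the canonical isomorphism G_theta / G_theta^+ = L_theta: it is tautological
   on constants in T(C) (and on those in Z(G), which lies in T(C)), and maps
   u_r(c z^(m_r)) to u_r(c) when r(theta) is an integer; its values outside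
   G_theta are irrelevant. *)
Definition levi_residue (theta : weight C n) (res : 'M[K]_n -> 'M[C]_n) :=
  [/\ forall g h, parahoric theta g -> parahoric theta h ->
        res (g *m h) = res g *m res h,
      res @` parahoric theta = levi theta,
      forall g, parahoric theta g ->
        (res g = 1%:M <-> prounipotent_radical theta g),
      forall t, (T `|` mx_center G) t -> res (map_mx laurent_const t) = t &
      forall r u c, is_root G T r -> weight_pairing theta r \is a Num.int ->
        root_hom G T (regeval idfun r) u ->
        res (polymx_eval laurent_const u
               (laurent_const c * laurent_z C ^ mlevel theta r)) =
        polymx_eval idfun u c].

End Parahoric.

(* A projective variety over C given by a generic point
   [xi_0 : ... : xi_N] with coordinates in its function field *)
Record projvar (C : fieldType) := Projvar {
  pdim : nat;
  funfield : fieldType;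
  fconst : {rmorphism C -> funfield};
  generic : 'I_pdim.+1 -> funfield
}.

Section Curves.
Variables (C : fieldType) (X : projvar C).
Local Notation N := (pdim X).
Local Notation F := (funfield X).

Definition at_generic (f : {mpoly C[N.+1]}) : F :=
  mmap (fconst X) (@generic _ X) f.
Definition at_pt (f : {mpoly C[N.+1]}) (p : 'rV[C]_N.+1) : C :=
  meval (fun i => p 0 i) f.

Definition form (d : nat) (f : {mpoly C[N.+1]}) : Prop := f \is d.-homog.

(* homogeneous coordinates normalized so that the first nonzero one is 1 *)
Definition normalized (p : 'rV[C]_N.+1) :=
  exists i, p 0 i = 1 /\ forall j : 'I_N.+1, (j < i)%N -> p 0 j = 0.

Definition on_variety (p : 'rV[C]_N.+1) :=
  forall d f, form d f -> at_generic f = 0 -> at_pt f p = 0.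

Definition curve_point : choiceType :=
  {p : 'rV[C]_N.+1 | `[< normalized p /\ on_variety p >]}.

Definition local_ring (p : curve_point) : set F :=
  [set h | exists d f g, [/\ form d f, form d g, at_pt g (val p) != 0 &
     h = at_generic f / at_generic g]].

Definition projective_variety :=
  (exists i, generic (p := X) i != 0) /\
  (forall h : F, exists d f g, [/\ form d f, form d g, at_generic g != 0 &
     h = at_generic f / at_generic g]).

(* the function field has transcendence degree 1 over C *)
Definition dimension_one :=
  (exists h : F, forall q : {poly C}, q != 0 ->
     (map_poly (fconst X) q).[h] != 0) /\
  (forall h : 'I_2 -> F, exists2 q : {mpoly C[2]}, q != 0 &
     mmap (fconst X) h q = 0).

(* Jacobian criterion: the tangent space of the affine cone along p has
   dimension at most 2 *)
Definition smooth_curve := forall p : curve_point, exists w : 'rV[C]_N.+1,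
  forall v : 'rV[C]_N.+1,
    (forall d f, form d f -> at_generic f = 0 ->
       \sum_i v 0 i * at_pt (mderiv i f) (val p) = 0) ->
    exists a b, v = a *: val p + b *: w.

Definition smooth_projective_curve :=
  [/\ projective_variety, dimension_one & smooth_curve].

(* loc : F -> C((z)) induces an isomorphism of the completed local ring at p
   with C[[z]] *)
Definition formal_coordinate (p : curve_point) (loc : F -> laurent C) :=
  [/\ forall c, loc (fconst X c) = laurent_const c,
      forall h, local_ring p h <-> integral (loc h) &
      exists h, zval (loc h) = 1].

End Curves.

Section Torsors.
Variables (C : fieldType) (X : projvar C).
Local Notation K := (laurent C).
Local Notation F := (funfield X).
Variable loc : curve_point X -> {rmorphism F -> K}.
Variables (s : nat) (D : 'I_s -> curve_point X).
Variables (n : nat) (G T : set 'M[C]_n) (theta : 'I_s -> weight C n).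

Definition localize (p : curve_point X) (g : 'M[F]_n) : 'M[K]_n := map_mx (loc p) g.

(* For a group scheme over X glued from H x (X \ D) and from the subgroups Q j
   at the points of D: its sections over the formal disc at p *)
Definition glued (H : set 'M[C]_n) (Q : 'I_s -> set 'M[K]_n) (p : curve_point X) :
  set 'M[K]_n :=
  [set g | (forall j, D j = p -> Q j g) /\
           ((forall j, D j <> p) -> Gintegral H g)].

Definition calG : curve_point X -> set 'M[K]_n :=
  glued G (fun j => parahoric G T (theta j)).

Definition calP (P : set 'M[C]_n) : curve_point X -> set 'M[K]_n :=
  glued P (fun j => parahoric_roots G T (theta j) (roots_of G T P)).

(* A torsor that is trivial over the generic point is given, after the choice
   of a generic trivialization, by its sections E p over each formal disc, seen
   as sections G(K) over the punctured disc *)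
Definition torsor_data : Type := curve_point X -> set 'M[K]_n.

Definition torsor (E : torsor_data) :=
  (forall p, exists2 g, points laurent_const G g & E p = lcoset g (calG p)) /\
  finite_set [set p | E p <> Gintegral G].

(* changes of generic trivialization carrying E1 to E2 *)
Definition torsor_iso (E1 E2 : torsor_data) : set 'M[F]_n :=
  [set g | points (fconst X) G g /\
           forall p, E2 p = lcoset (localize p g) (E1 p)].

Definition torsor_aut (E : torsor_data) : set 'M[F]_n := torsor_iso E E.

(* A reduction of E to calP: the P-torsor a P over the generic point, and the
   calP-torsors q p (calP p) over the formal discs *)
Definition reduction (E : torsor_data) (P : set 'M[C]_n) (a : 'M[F]_n)
    (q : curve_point X -> 'M[K]_n) :=
  points (fconst X) G a /\
  forall p, E p (q p) /\
    lcoset (localize p a) (points laurent_const P) (q p).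

(* Degree of the line bundle associated with the character chi: its fibre over
   the generic point is trivialized by a, and q p gives the local frame
   chi (a^-1 q_p) *)
Definition reduction_degree (chi : regfun C n) (a : 'M[F]_n)
    (q : curve_point X -> 'M[K]_n) : int :=
  - \sum_(p \in [set: curve_point X])
      zval (regeval laurent_const chi (invmx (localize p a) *m q p)).

Definition stable (E : torsor_data) :=
  forall P : set 'M[C]_n, parabolic G P -> T `<=` P -> P <> G ->
  forall a q, reduction E P a q ->
  forall chi, antidominant G T P chi -> nontrivial_on P chi ->
    0 < (reduction_degree chi a q)%:~R
        + \sum_(j < s) weight_pairing (theta j) chi.

Definition regularly_stable (E : torsor_data) :=
  stable E /\
  torsor_aut E = [set map_mx (fconst X) z | z in mx_center G].

(* A level structure at D j is a section of E / G_theta^+ over the formal disc,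
   i.e. a left coset of G_theta^+ in E (D j) *)
Definition level_data : Type := (torsor_data * ('I_s -> set 'M[K]_n))%type.

Definition level_pair (Eeta : level_data) :=
  torsor Eeta.1 /\
  forall j, exists2 e, Eeta.1 (D j) e &
    Eeta.2 j = lcoset e (prounipotent_radical G T (theta j)).

Definition level_equiv (Eeta1 Eeta2 : level_data) :=
  exists2 h, torsor_iso Eeta1.1 Eeta2.1 h &
    forall j, Eeta2.2 j = lcoset (localize (D j) h) (Eeta1.2 j).

Definition level_class (Eeta : level_data) : set level_data :=
  [set Eeta' | level_pair Eeta' /\ level_equiv Eeta Eeta'].

(* closed points of the moduli spaces, as equivalence classes *)
Definition moduli_of (Q : torsor_data -> Prop) : set (set level_data) :=
  [set level_class Eeta | Eeta in [set Eeta | level_pair Eeta /\ Q Eeta.1]].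

Definition moduli := moduli_of stable.
Definition moduli_rs := moduli_of regularly_stable.

Definition level_tuple : Type := 'I_s -> 'M[C]_n.

(* the elements of G_D are the cosets g Z, Z embedded diagonally *)
Definition level_coset (g : level_tuple) : set level_tuple :=
  [set (fun j => g j *m z) | z in mx_center G].

Definition level_group : set (set level_tuple) :=
  [set level_coset g | g in [set g : level_tuple |
     forall j, levi G T (theta j) (g j)]].

Definition level_one : set level_tuple := level_coset (fun=> 1%:M).

Definition level_mul (a b : set level_tuple) : set level_tuple :=
  [set (fun j => g j *m h j) | g in a & h in b].

Variable res : 'I_s -> 'M[K]_n -> 'M[C]_n.

(* Left action on level structures: calG acts on E from the right, so g acts by
   e |-> e k^-1 for the lifts k of g to G_theta *)
Definition level_act1 (g : level_tuple) (Eeta : level_data) : level_data :=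
  (Eeta.1, fun j => [set e *m invmx k | e in Eeta.2 j & k in
     [set k | parahoric G T (theta j) k /\ res j k = g j]]).

Definition level_act (a : set level_tuple) (c : set level_data) :
  set level_data := [set level_act1 g Eeta | g in a & Eeta in c].

End Torsors.

Definition acts_freely (A B : Type) (Gr : set A) (one : A) (mul : A -> A -> A)
    (act : A -> B -> B) (Y : set B) :=
  [/\ forall a y, Gr a -> Y y -> Y (act a y),
      forall y, Y y -> act one y = y,
      forall a b y, Gr a -> Gr b -> Y y -> act (mul a b) y = act a (act b y) &
      forall a y, Gr a -> Y y -> act a y = y -> a = one].

(* Main.v *)
Require Import Defs.
From HB Require Import structures.
From mathcomp Require Import all_boot all_order all_algebra.
From mathcomp Require Import boolp classical_sets reals complex mpoly.

Set Implicit Arguments.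
Unset Strict Implicit.
Unset Printing Implicit Defensive.
Import GRing.Theory.
Local Open Scope classical_set_scope.
Local Open Scope ring_scope.

(** The action is free because the only automorphisms that could identify a
level structure with a translate of it are central, and a central element
acts on all the level structures as the same element of the Levi groups.

In detail, a level structure at a marked point is a coset e G_theta^+ in the
sections of the torsor over the formal disc, and an element g of L_theta moves
it to e k^-1 G_theta^+ for any lift k of g to G_theta; this is well defined
because the residue map identifies G_theta / G_theta^+ with L_theta. These
right translations commute with changes of the generic trivialization, which
act on the left. So L_theta1 x ... x L_thetas acts on pairs and on their
equivalence classes [level_act1_pair, level_act1_equiv].

The diagonal copy of Z = Z(G) acts trivially on the classes: for z in Z,
moving a level structure by z^-1 on the right is the same, up to G_theta^+, as
moving it by z^-1 on the left, which is the effect of an automorphism of the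
torsor [level_equiv_center]. Conversely, if g sends a pair with torsor E to an
equivalent one, the equivalence is an automorphism of E, hence some z in Z by
regular stability; comparing the cosets at each marked point gives
g_j = z^-1 for all j, so that g is trivial in the level group
[level_stabilizer_central].

Both halves use that the constants in Z lie in every parahoric group. This
follows from the existence of E: its automorphism z preserves the sections
x G_theta over the disc, and x commutes with z, so that z preserves G_theta
itself [center_parahoric]. *)

(** * Constant Laurent series *)

Section LaurentConst.
Variable C : fieldType.

Fact laurent_const_zmod : zmod_morphism (@laurent_const C).
Proof.
move=> a b; rewrite /laurent_const /of_fps -tofracB; congr FracField.tofrac.
by apply: fpsP => k /=; rewrite mulrnBl.
Qed.

Fact laurent_const_monoid : monoid_morphism (@laurent_const C).
Proof.
split; first exact: tofrac1.
move=> a b; rewrite /laurent_const /of_fps -tofracM; congr FracField.tofrac.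
apply: fpsP => k /=; rewrite big_ord_recl /= subn0 big1 ?addr0.
  by rewrite mulr1n -mulrnAr.
by move=> l _; rewrite mulr0n mul0r.
Qed.

HB.instance Definition _ :=
  GRing.isZmodMorphism.Build C (laurent C) laurent_const laurent_const_zmod.
HB.instance Definition _ :=
  GRing.isMonoidMorphism.Build C (laurent C) laurent_const laurent_const_monoid.

End LaurentConst.

(** * Matrix groups and their cosets *)

Section MatrixGroups.
Variables (S : fieldType) (n : nat).
Implicit Types (A B H : set 'M[S]_n) (g h x : 'M[S]_n).

Lemma lcosetM g h A : lcoset g (lcoset h A) = lcoset (g *m h) A.
Proof.
apply/seteqP; split=> x /=.
  by case=> _ [y Ay <-] <-; exists y => //; rewrite mulmxA.
by case=> y Ay <-; exists (h *m y); [exists y | rewrite mulmxA].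
Qed.

Lemma lcoset1 A : lcoset 1%:M A = A.
Proof.
apply/seteqP; split=> x /=; first by case=> y Ay <-; rewrite mul1mx.
by move=> Ax; exists x => //; rewrite mul1mx.
Qed.

Lemma lcoset_id H h : mx_subgroup H -> H h -> lcoset h H = H.
Proof.
case=> uH _ HM HV Hh; apply/seteqP; split=> x /=.
  by case=> y Hy <-; apply: HM.
by move=> Hx; exists (invmx h *m x);
  [apply: HM => //; apply: HV | rewrite mulKVmx //; apply: uH].
Qed.

Lemma mx_gen_ge A : A `<=` mx_gen A.
Proof. by move=> g Ag H _; apply. Qed.

Lemma mx_gen_min A H : mx_subgroup H -> A `<=` H -> mx_gen A `<=` H.
Proof. by move=> sH AH g; apply. Qed.

Lemma unitmx_subgroup : mx_subgroup [set g : 'M[S]_n | g \in unitmx].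
Proof.
split=> //=; first exact: unitmx1.
- by move=> g h; rewrite unitmx_mul => -> ->.
- by move=> g; rewrite unitmx_inv.
Qed.

(** A set with a singular element lies in no group of matrices, and [mx_gen]
then returns the set of all matrices: hence the hypothesis. *)
Lemma mx_gen_subgroup A :
  A `<=` [set g | g \in unitmx] -> mx_subgroup (mx_gen A).
Proof.
move=> uA; split.
- exact: mx_gen_min unitmx_subgroup uA.
- by move=> H [].
- by move=> g h gA hA H sH AH; case: (sH) => _ _ HM _; apply: HM;
    [apply: gA | apply: hA].
- by move=> g gA H sH AH; case: (sH) => _ _ _ HV; apply: HV; apply: gA.
Qed.

Lemma mx_subgroup_unit H g : mx_subgroup H -> H g -> g \in unitmx.
Proof. by case=> uH _ _ _; apply: uH. Qed.

Lemma mx_subgroupV H g : mx_subgroup H -> H g -> H (invmx g).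
Proof. by case=> _ _ _; apply. Qed.

Lemma invmx_mul g h :
  g \in unitmx -> h \in unitmx -> invmx (g *m h) = invmx h *m invmx g.
Proof.
move=> ug uh; have ugh : g *m h \in unitmx by rewrite unitmx_mul ug.
by rewrite -[LHS](mulKmx uh) -[h *m _](mulKmx ug) (mulmxA g) mulmxV // mulmx1.
Qed.

Lemma mx_center_subgroup H : mx_subgroup H -> mx_subgroup (mx_center H).
Proof.
move=> sH; have [uH H1 HM HV] := sH.
split=> [z [/uH//]||z w [Hz zC] [Hw wC]|z [Hz zC]].
- by split=> // g _; rewrite mul1mx mulmx1.
- by split=> [|g Hg]; [apply: HM | rewrite -mulmxA wC // !mulmxA zC].
- split=> [|g Hg]; first exact: HV.
  by rewrite -{2}(mulKmx (uH _ Hz) g) zC // -!mulmxA mulmxV ?mulmx1 ?uH.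
Qed.

End MatrixGroups.

(** * Points of a linear group over an extension field *)

Section Points.
Variables (C S : fieldType) (i : {rmorphism C -> S}) (n : nat).
Implicit Types (x : 'M[S]_n) (g z : 'M[C]_n) (f : {mpoly C[n * n]}).

(** The universal matrix: an identity between entries of products of
[generic_mx] and constant matrices is an identity between regular functions,
and [mxeval] turns it into the same identity at any given point. *)
Definition generic_mx : 'M[{mpoly C[n * n]}]_n :=
  \matrix_(a, b) 'X_(mxvec_index a b).

Definition mpolyC_mx z : 'M[{mpoly C[n * n]}]_n := map_mx (@mpolyC _ _) z.

Lemma mxeval_generic x :
  map_mx (fun f => mxeval i f x) generic_mx = x.
Proof.
by apply/matrixP=> a b; rewrite !mxE /mxeval mmapX mmap1U mxvecE.
Qed.

Lemma mxeval_mpolyC_mx z x :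
  map_mx (fun f => mxeval i f x) (mpolyC_mx z) = map_mx i z.
Proof. by apply/matrixP=> a b; rewrite !mxE /mxeval mmapC. Qed.

Lemma map_mxevalM (A B : 'M[{mpoly C[n * n]}]_n) x :
  map_mx (fun f => mxeval i f x) (A *m B) =
  map_mx (fun f => mxeval i f x) A *m map_mx (fun f => mxeval i f x) B.
Proof. exact: (map_mxM (mmap i (fun k => mxvec x 0 k))). Qed.

(** The polynomial function x |-> f (g x). *)
Definition left_subst g f : {mpoly C[n * n]} :=
  mmap (@mpolyC _ _) (fun k => mxvec (mpolyC_mx g *m generic_mx) 0 k) f.

Lemma mxeval_left_subst g f x :
  mxeval i (left_subst g f) x = mxeval i f (map_mx i g *m x).
Proof.
have mxE' : map_mx (fun f => mxeval i f x) (mpolyC_mx g *m generic_mx) =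
    map_mx i g *m x.
  by rewrite map_mxevalM mxeval_mpolyC_mx mxeval_generic.
rewrite /mxeval /left_subst {1}[mmap (@mpolyC _ _) _ _]/mmap rmorph_sum.
apply: eq_bigr => m _; rewrite rmorphM /= mmapC; congr (_ * _).
rewrite /mmap1 rmorph_prod; apply: eq_bigr => k _; rewrite rmorphXn.
congr (_ ^+ _); rewrite -mxE'.
by case/mxvec_indexP: k => a b; rewrite !mxvecE [RHS]mxE.
Qed.

End Points.

Section PointsOfGroup.
Variables (C S : fieldType) (i : {rmorphism C -> S}) (n : nat).
Variable G : set 'M[C]_n.
Hypothesis sG : mx_subgroup G.
Implicit Types (x : 'M[S]_n) (g z : 'M[C]_n) (f : {mpoly C[n * n]}).

Lemma points_unit x : points i G x -> x \in unitmx. Proof. by case. Qed.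

Lemma vanishing_left_subst g f :
  G g -> vanishing G f -> vanishing G (left_subst g f).
Proof.
case: sG => _ _ GM _ Gg fG h Gh.
rewrite (mxeval_left_subst idfun) map_mx_id //; apply: fG; exact: GM.
Qed.

(** If f vanishes on G, so does f (g x); the defining equations of the points
over an extension are therefore stable under translation by g. *)
Lemma points_left_mul g x : G g -> points i G x -> points i G (map_mx i g *m x).
Proof.
move=> Gg [ux vx]; split=> [|f fG].
  by rewrite unitmx_mul map_unitmx (mx_subgroup_unit sG Gg).
by rewrite -mxeval_left_subst; apply: vx; apply: vanishing_left_subst.
Qed.

(** Commuting with z is a system of linear equations with coefficients in the
base field; G satisfies it, hence so do its points over any extension. *)
Lemma points_center_comm z x :
  mx_center G z -> points i G x -> map_mx i z *m x = x *m map_mx i z.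
Proof.
case=> _ zC [_ vx].
pose comm_mx := mpolyC_mx z *m generic_mx C n - generic_mx C n *m mpolyC_mx z.
have comm_ev (S' : fieldType) (i' : {rmorphism C -> S'}) (y : 'M[S']_n) a b :
    mxeval i' (comm_mx a b) y =
    (map_mx i' z *m y - y *m map_mx i' z) a b.
  have := congr1 (fun M : 'M[S']_n => M a b)
    (map_mxB (mmap i' (fun k => mxvec y 0 k)) (mpolyC_mx z *m generic_mx C n)
       (generic_mx C n *m mpolyC_mx z)).
  by rewrite [LHS]mxE !map_mxevalM mxeval_mpolyC_mx mxeval_generic.
apply/eqP; rewrite -subr_eq0; apply/eqP/matrixP=> a b; rewrite [RHS]mxE.
rewrite -comm_ev; apply: vx => g Gg.
by rewrite (comm_ev _ idfun) map_mx_id // zC // subrr mxE.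
Qed.

End PointsOfGroup.

Section RootUnits.
Variables (C : closedFieldType) (S : fieldType) (i : {rmorphism C -> S}).
Variables (n : nat) (G T : set 'M[C]_n).
Hypothesis sG : mx_subgroup G.

Lemma det_polymx_eval (F S' : fieldType) (j : {rmorphism F -> S'}) m
    (u : 'M[{poly F}]_m) (c : S') :
  \det (polymx_eval j u c) = (map_poly j (\det u)).[c].
Proof.
have -> : polymx_eval j u c = map_mx (horner_eval c) (map_mx (map_poly j) u).
  by apply/matrixP=> a b; rewrite !mxE.
by rewrite !det_map_mx.
Qed.

(** The determinant of u is a polynomial without zeros over an algebraically
closed field, hence a nonzero constant, so that u stays invertible when its
variable takes values in an extension. *)
Lemma root_subgroup_unit rho (I : set S) :
  root_subgroup G T rho i I `<=` [set g | g \in unitmx].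
Proof.
move=> _ [u [Gu _ _ _] [c _ ->]] /=.
have det_n0 (a : C) : (\det u).[a] != 0.
  have /(mx_subgroup_unit sG) := Gu a.
  by rewrite unitmxE (det_polymx_eval idfun) map_poly_id // unitfE.
have size_det : size (\det u) == 1.
  apply: contraT => /closed_rootP [a /rootP det_a].
  by have := det_n0 a; rewrite det_a eqxx.
have [d det_u] : exists d, \det u = d%:P.
  by exists (\det u)`_0; apply: size1_polyC; rewrite (eqP size_det).
rewrite unitmxE det_polymx_eval det_u map_polyC hornerC unitfE fmorph_eq0.
by have := det_n0 0; rewrite det_u hornerC.
Qed.

End RootUnits.

(** * Translating cosets of the kernel of a residue map *)

(** For a residue map P -> L with kernel N, the element g of L acts on the
cosets of N by right translation with the inverse of a lift. Taking all the
lifts avoids a choice, and defines the translate of an arbitrary set. *)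
Definition residue_shift (C K : fieldType) n (P : set 'M[K]_n)
    (res : 'M[K]_n -> 'M[C]_n) (g : 'M[C]_n) (eta : set 'M[K]_n) :=
  [set e *m invmx k | e in eta & k in [set k | P k /\ res k = g]].

Section Residue.
Variables (C K : fieldType) (n : nat).
Variables (P N : set 'M[K]_n) (L : set 'M[C]_n) (res : 'M[K]_n -> 'M[C]_n).
Hypotheses (sP : mx_subgroup P) (sL : mx_subgroup L) (NP : N `<=` P).
Hypothesis resM : forall g h, P g -> P h -> res (g *m h) = res g *m res h.
Hypothesis resP : res @` P = L.
Hypothesis resN : forall g, P g -> (res g = 1%:M <-> N g).

Lemma res_mem k : P k -> L (res k).
Proof. by move=> Pk; rewrite -resP; exists k. Qed.

Lemma res_unit k : P k -> res k \in unitmx.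
Proof. by move=> Pk; apply: mx_subgroup_unit sL _; apply: res_mem. Qed.

Lemma res1 : res 1%:M = 1%:M.
Proof.
have P1 : P 1%:M by case: sP.
by rewrite -[LHS](mulKmx (res_unit P1)) -resM // mulmx1 mulVmx // res_unit.
Qed.

Lemma resV k : P k -> res (invmx k) = invmx (res k).
Proof.
move=> Pk; have PVk : P (invmx k) by case: sP => _ _ _; apply.
rewrite -[LHS](mulKmx (res_unit Pk)) -resM // mulmxV ?res1 ?mulmx1 //.
exact: mx_subgroup_unit Pk.
Qed.

Lemma kernel_subgroup : mx_subgroup N.
Proof.
have [uP P1 PM PV] := sP.
split=> [g /NP/uP //||g h Ng Nh|g Ng].
- by apply/(resN P1); apply: res1.
- have [Pg Ph] := (NP Ng, NP Nh); apply/resN; first exact: PM.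
  by rewrite resM // (resN Pg).2 // (resN Ph).2 // mulmx1.
- have Pg := NP Ng; apply/resN; first exact: PV.
  by rewrite resV // (resN Pg).2 // invmx1.
Qed.

Lemma eq_res_lcoset h k :
  P h -> P k -> res h = res k -> lcoset h N = lcoset k N.
Proof.
have [uP P1 PM PV] := sP => Ph Pk hk.
rewrite -[h](mulKVmx (uP _ Pk)) -lcosetM (lcoset_id kernel_subgroup) //.
have Pkh : P (invmx k *m h) by apply: PM => //; apply: PV.
by apply/(resN Pkh); rewrite resM ?resV ?hk ?mulVmx ?res_unit //; apply: PV.
Qed.

(** The element g lies in g N = h N, hence in P. *)
Lemma lcoset_eq_res g h :
  P h -> lcoset g N = lcoset h N -> P g /\ res g = res h.
Proof.
have [uP P1 PM PV] := sP => Ph gh.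
have : lcoset g N g.
  by exists 1%:M; [case: kernel_subgroup | rewrite mulmx1].
rewrite gh => -[m Nm <-]; have Pm := NP Nm.
by rewrite resM // (resN Pm).2 // mulmx1; split=> //; apply: PM.
Qed.

(** N is normal in P, as a kernel, so that e N k'^-1 = e k^-1 N for every lift
k' of the residue of k. *)
Lemma residue_shift_coset k e :
  P k -> residue_shift P res (res k) (lcoset e N) = lcoset (e *m invmx k) N.
Proof.
have [uP P1 PM PV] := sP => Pk; have [uN N1 NM NV] := kernel_subgroup.
apply/seteqP; split=> x.
  case=> _ [m Nm <-] [k' [Pk' kk'] <-].
  have : lcoset (m *m invmx k') N (m *m invmx k').
    by exists 1%:M; rewrite ?mulmx1.
  have Pm := NP Nm.
  rewrite (@eq_res_lcoset _ (invmx k)); first last.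
  - by rewrite resM ?resV ?(resN Pm).2 ?mul1mx ?kk' //; apply: PV.
  - exact: PV.
  - by apply: PM => //; apply: PV.
  by case=> m' Nm' mm'; exists m'; rewrite // -!mulmxA mm'.
case=> m Nm <-; exists e; first by exists 1%:M; rewrite ?mulmx1.
have Pm := NP Nm.
exists (invmx m *m k); last first.
  by rewrite invmx_mul ?unitmx_inv ?invmxK ?mulmxA //; [apply: uN | apply: uP].
split; first by apply: PM => //; apply: PV.
by rewrite resM ?resV ?(resN Pm).2 ?invmx1 ?mul1mx //; apply: PV.
Qed.

Lemma residue_shift_lcoset g h eta :
  residue_shift P res g (lcoset h eta) = lcoset h (residue_shift P res g eta).
Proof.
apply/seteqP; split=> x.
  case=> _ [e eta_e <-] [k Pk <-].
  by exists (e *m invmx k); [exists e => //; exists k | rewrite mulmxA].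
case=> _ [e eta_e [k Pk <-]] <-.
by exists (h *m e); [exists e | exists k; rewrite ?mulmxA].
Qed.

(** A lift k of g h is the product of k k2^-1, which lifts g, and of any given
lift k2 of h; such a k2 exists because h is in L. *)
Lemma residue_shiftM g h eta : L h ->
  residue_shift P res (g *m h) eta =
  residue_shift P res g (residue_shift P res h eta).
Proof.
have [uP P1 PM PV] := sP; rewrite -resP => -[k2 Pk2 res_k2].
apply/seteqP; split=> x.
  case=> e eta_e [k [Pk res_k] <-].
  exists (e *m invmx k2); first by exists e => //; exists k2.
  exists (k *m invmx k2); last first.
    by rewrite invmx_mul ?unitmx_inv ?uP // invmxK mulmxA mulmxKV ?uP.
  split; first by apply: PM => //; apply: PV.
  rewrite resM ?resV ?res_k ?res_k2; [|by []..|exact: PV].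
  by rewrite mulmxK // -res_k2 res_unit.
case=> _ [e eta_e [k [Pk res_k] <-]] [k1 [Pk1 res_k1] <-].
exists e => //; exists (k1 *m k).
  by split; [apply: PM | rewrite resM ?res_k ?res_k1].
by rewrite invmx_mul ?uP // mulmxA.
Qed.

End Residue.

(** * The action on level structures *)

Section LevelStructures.
Variables (C : closedFieldType) (X : projvar C).
Local Notation F := (funfield X).
Local Notation K := (laurent C).
Variable loc : curve_point X -> {rmorphism F -> K}.
Hypothesis locC : forall p c, loc p (fconst X c) = laurent_const c.
Variables (s : nat) (D : 'I_s -> curve_point X).
Hypothesis injD : injective D.
Variables (n : nat) (G T : set 'M[C]_n) (theta : 'I_s -> weight C n).
Hypotheses (sG : mx_subgroup G) (TG : T `<=` G).
Variable res : 'I_s -> 'M[K]_n -> 'M[C]_n.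
Hypothesis resH : forall j, levi_residue G T (theta j) (res j).
Implicit Types (E : torsor_data X n) (A B : level_data X s n).
Implicit Types (z : 'M[C]_n) (g : level_tuple C s n).

Local Notation P j := (parahoric G T (theta j)).
Local Notation N j := (prounipotent_radical G T (theta j)).
Local Notation L j := (levi G T (theta j)).
Local Notation const := (map_mx laurent_const).
Local Notation constF := (map_mx (fconst X)).
Local Notation act1 := (level_act1 G T theta res).

Lemma localize_const p z : localize loc p (constF z) = const z.
Proof. by apply/matrixP=> a b; rewrite !mxE locC. Qed.

Lemma levi_sub j : L j `<=` G.
Proof.
apply: mx_gen_min => // t [/TG//|[r [_ _ [u [Gu _ _ _] [c _ ->]]]]].
exact: Gu.
Qed.

Lemma levi_subgroup j : mx_subgroup (L j).
Proof.
apply: mx_gen_subgroup => t Lt; apply: (mx_subgroup_unit sG).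
by apply: (@levi_sub j); apply: mx_gen_ge.
Qed.

Lemma parahoric_subgroup j : mx_subgroup (P j).
Proof.
apply: mx_gen_subgroup => t [[[]]//|[r _ rt]].
exact: root_subgroup_unit rt.
Qed.

Lemma radical_sub j : N j `<=` P j.
Proof. by move=> t [H [[_ HP _] _ /HP]]. Qed.

Let resM j : forall k l, P j k -> P j l -> res j (k *m l) = res j k *m res j l.
Proof. by case: (resH j). Qed.
Let resP j : res j @` P j = L j.
Proof. by case: (resH j). Qed.
Let resN j : forall k, P j k -> (res j k = 1%:M <-> N j k).
Proof. by case: (resH j). Qed.
Let resZ j z : mx_center G z -> res j (const z) = z.
Proof. by case: (resH j) => _ _ _ resC _ Zz; apply: resC; right. Qed.

(** As the marked points are distinct, only the weight theta j constrains the
sections over the disc at D j. *)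
Lemma calG_marked j : calG D G T theta (D j) = P j.
Proof.
apply/seteqP; split=> t; first by case=> + _; apply.
by move=> Pt; split=> [k /injD ->//|/(_ j)/(_ erefl)].
Qed.

Lemma level_pairE A j : level_pair D G T theta A ->
  exists x h, [/\ points laurent_const G x, P j h,
    A.1 (D j) = lcoset x (P j) & A.2 j = lcoset (x *m h) (N j)].
Proof.
case=> -[EG _] lv; have [x Gx EDx] := EG (D j); have [e] := lv j.
rewrite EDx calG_marked => -[h Ph <-] Aj.
by exists x, h.
Qed.

Lemma level_act1_coset g A j k e : P j k -> res j k = g j ->
  A.2 j = lcoset e (N j) -> (act1 g A).2 j = lcoset (e *m invmx k) (N j).
Proof.
move=> Pk gk Aj; rewrite /= -gk Aj.
exact: (residue_shift_coset (parahoric_subgroup j) (levi_subgroup j)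
  (@radical_sub j) (@resM j) (resP j) (@resN j)).
Qed.

Lemma level_act1M g (h : level_tuple C s n) A : (forall j, L j (h j)) ->
  act1 (fun j => g j *m h j) A = act1 g (act1 h A).
Proof.
move=> Lh; congr pair; apply/funext => j.
exact: (residue_shiftM (parahoric_subgroup j) (levi_subgroup j) (@resM j)
  (resP j)).
Qed.

Lemma level_act1_pair g A : (forall j, L j (g j)) ->
  level_pair D G T theta A -> level_pair D G T theta (act1 g A).
Proof.
move=> Lg pA; split=> [|j]; first by case: pA.
have [x [h [Gx Ph EDx Aj]]] := level_pairE j pA.
have := Lg j; rewrite -resP => -[k Pk gk].
exists (x *m h *m invmx k); last exact: level_act1_coset Aj.
have [_ _ PM PV] := parahoric_subgroup j.
rewrite /= EDx; exists (h *m invmx k); last by rewrite mulmxA.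
by apply: PM => //; apply: PV.
Qed.

Lemma level_act1_equiv g A B :
  level_equiv loc D G A B -> level_equiv loc D G (act1 g A) (act1 g B).
Proof.
case=> h isoh ABh; exists h => // j.
by rewrite -residue_shift_lcoset -ABh.
Qed.

Lemma level_act1_1 A : level_pair D G T theta A ->
  act1 (fun=> 1%:M) A = A.
Proof.
move=> pA; rewrite [RHS]surjective_pairing; congr pair; apply/funext => j.
have [x [h [_ _ _ Aj]]] := level_pairE j pA.
have [_ P1 _ _] := parahoric_subgroup j.
rewrite -[LHS]/((act1 (fun=> 1%:M) A).2 j).
rewrite (level_act1_coset P1 _ Aj) ?invmx1 ?mulmx1 //.
exact: (res1 (parahoric_subgroup j) (levi_subgroup j) (@resM j) (resP j)).
Qed.

(** * The center and regular stability *)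

Section CenterFixing.
Variable E : torsor_data X n.
Hypothesis torE : torsor D G T theta E.
Hypothesis autE : forall z, mx_center G z -> torsor_aut loc G E (constF z).

Lemma center_fixes z p : mx_center G z -> E p = lcoset (const z) (E p).
Proof. by move=> /autE[_ /(_ p)]; rewrite localize_const. Qed.

(** The automorphism z of E preserves E (D j) = x G_theta, so z x = x k with k
in G_theta, and k = z because x commutes with z. *)
Lemma center_parahoric j z : mx_center G z -> P j (const z).
Proof.
move=> Zz; have [x Gx EDx] := torE.1 (D j).
have ux := points_unit Gx.
have [uP P1 PM PV] := parahoric_subgroup j.
have : E (D j) (const z *m x).
  rewrite (center_fixes _ Zz); exists x => //.
  by rewrite EDx calG_marked; exists 1%:M; rewrite ?mulmx1.
rewrite EDx calG_marked => -[k Pk].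
rewrite (points_center_comm Zz Gx) => /(congr1 (mulmx (invmx x))).
by rewrite !mulKmx // => <-.
Qed.

Lemma center_levi j z : mx_center G z -> L j z.
Proof.
move=> Zz; rewrite -(resZ j Zz).
by apply: (res_mem (resP j)); apply: center_parahoric.
Qed.

(** The residue of z is z, which commutes with L_theta: z and h commute modulo
the kernel of the residue map. *)
Lemma center_commutes_mod_radical j z h : mx_center G z -> P j h ->
  lcoset (const z *m h) (N j) = lcoset (h *m const z) (N j).
Proof.
move=> Zz Ph; have Pz : P j (const z) by apply: center_parahoric.
have [_ _ PM _] := parahoric_subgroup j.
apply: (eq_res_lcoset (parahoric_subgroup j) (levi_subgroup j)
  (@radical_sub j) (@resM j) (resP j) (@resN j)); try exact: PM.
rewrite !resM // resZ //; case: Zz => _ ->//.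
by apply: (@levi_sub j); apply: (res_mem (resP j)).
Qed.

(** The constant z is itself a lift of z, so that z acts by right translation
by z^-1; the latter moves to the left of x h, where B.2 j = x h G_theta^+. *)
Lemma level_act1_center z B j : mx_center G z ->
    level_pair D G T theta B ->
  (act1 (fun=> z) B).2 j = lcoset (const (invmx z)) (B.2 j).
Proof.
move=> Zz pB; have [x [h [Gx Ph _ Bj]]] := level_pairE j pB.
have ZVz := mx_subgroupV (mx_center_subgroup sG) Zz.
rewrite (level_act1_coset (center_parahoric (j := j) Zz) _ Bj) ?resZ // Bj.
rewrite -map_invmx lcosetM mulmxA (points_center_comm ZVz Gx) // -!mulmxA.
by rewrite -!(lcosetM x) center_commutes_mod_radical.
Qed.

(** If h is an equivalence from A to B, then z^-1 h is one from A to the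
translate of B: it maps onto the torsor of B since z^-1 h = h z^-1 and z^-1 is
an automorphism of the torsor of A, and it has the required effect on the level
structures by [level_act1_center]. *)
Lemma level_equiv_center A B z : A.1 = E -> mx_center G z ->
    level_pair D G T theta B -> level_equiv loc D G A B ->
  level_equiv loc D G A (act1 (fun=> z) B).
Proof.
move=> AE Zz pB [h [Gh EBh] ABh].
have ZVz := mx_subgroupV (mx_center_subgroup sG) Zz.
have locM p : localize loc p (constF (invmx z) *m h) =
    const (invmx z) *m localize loc p h.
  by rewrite -(localize_const p) /localize map_mxM.
exists (constF (invmx z) *m h).
  split=> [|p]; first by apply: points_left_mul => //; case: ZVz.
  rewrite /= EBh locM -locM (points_center_comm ZVz Gh) AE.
  rewrite {1}(center_fixes p ZVz).
  by rewrite lcosetM -(localize_const p) /localize -map_mxM.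
by move=> j; rewrite level_act1_center // ABh lcosetM locM.
Qed.

End CenterFixing.

Section RegularlyStableClass.
Variable A : level_data X s n.
Hypothesis pA : level_pair D G T theta A.
Hypothesis autA : torsor_aut loc G A.1 = [set constF z | z in mx_center G].

Let autZ z : mx_center G z -> torsor_aut loc G A.1 (constF z).
Proof. by move=> Zz; rewrite autA; exists z. Qed.

Lemma level_equiv_refl : level_equiv loc D G A A.
Proof.
have [_ Z1 _ _] := mx_center_subgroup sG.
exists (constF 1%:M) => [|j]; first exact: autZ.
by rewrite localize_const map_mx1 lcoset1.
Qed.

(** The set-level action of a coset g Z on a class is thus computed on
representatives. One inclusion says that Z acts trivially on the class of A,
the other one is obtained by translating back by g^-1. *)
Lemma level_act_coset g : (forall j, L j (g j)) ->
  level_act G T theta res (level_coset G g) (level_class loc D G T theta A) =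
  level_class loc D G T theta (act1 g A).
Proof.
move=> Lg; have torA : torsor D G T theta A.1 by case: pA.
have [_ Z1 _ _] := mx_center_subgroup sG.
apply/seteqP; split=> B.
  case=> _ [z Zz <-] [B' [pB' AB'] <-].
  have Lz j : L j z := center_levi torA (@autZ) Zz.
  rewrite (level_act1M g (h := fun=> z)) //; split.
    by apply: level_act1_pair => //; apply: level_act1_pair.
  apply: level_act1_equiv.
  exact: (level_equiv_center torA (@autZ)) Zz pB' AB'.
case=> pB gAB; pose g' j := invmx (g j).
have ug j : g j \in unitmx by apply: mx_subgroup_unit (levi_subgroup j) _.
have Lg' j : L j (g' j) by have [_ _ _] := levi_subgroup j; apply.
exists g.
  by exists 1%:M => //; apply/funext => j; rewrite mulmx1.
exists (act1 g' B); last first.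
  rewrite -level_act1M // -[RHS]level_act1_1 //; congr (act1 _ B).
  by apply/funext => j; rewrite mulmxV.
split; first exact: level_act1_pair.
have := level_act1_equiv g' gAB; rewrite -level_act1M //.
rewrite (_ : (fun j => g' j *m g j) = fun=> 1%:M) ?level_act1_1 //.
by apply/funext => j; rewrite mulVmx.
Qed.

(** The equivalence is an automorphism of the torsor, that is some z in Z. If
A.2 j = x l G_theta^+ and k lifts g j, then x l k^-1 and z x l = x z l define
the same coset; taking residues after cancelling x and commuting z with l leaves
g j^-1 = z. *)
Lemma level_stabilizer_central g :
  (forall j, L j (g j)) -> level_equiv loc D G A (act1 g A) ->
  exists2 z, mx_center G z & g = fun=> z.
Proof.
have torA : torsor D G T theta A.1 by case: pA.
move=> Lg [h]; rewrite -[torsor_iso _ _ _ _]/(torsor_aut loc G A.1) autA.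
move=> -[z Zz <-] actj; exists (invmx z).
  exact: mx_subgroupV (mx_center_subgroup sG) Zz.
apply/funext => j; have [x [l [Gx Pl _ Aj]]] := level_pairE j pA.
have := Lg j; rewrite -resP => -[k Pk gk].
have [uP P1 PM PV] := parahoric_subgroup j.
have Pz : P j (const z) := center_parahoric torA (@autZ) (j := j) Zz.
have := actj j; rewrite (level_act1_coset Pk gk Aj) Aj localize_const.
rewrite lcosetM mulmxA (points_center_comm Zz Gx) -!mulmxA -!(lcosetM x).
rewrite (center_commutes_mod_radical torA (@autZ)) //.
rewrite !lcosetM => /(congr1 (lcoset (invmx x))).
rewrite !lcosetM !mulKmx ?(points_unit Gx) // => lk_lz.
have Plz : P j (l *m const z) by apply: PM.
have [_] := lcoset_eq_res (parahoric_subgroup j) (levi_subgroup j)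
  (@radical_sub j) (@resM j) (resP j) (@resN j) Plz lk_lz.
have ul := res_unit (levi_subgroup j) (resP j) Pl.
rewrite !resM //; last exact: PV.
rewrite (resV (parahoric_subgroup j) (levi_subgroup j) (@resM j) (resP j)) //.
rewrite resZ // gk => /(congr1 (mulmx (invmx (res j l)))).
by rewrite !mulKmx // => <-; rewrite invmxK.
Qed.

End RegularlyStableClass.
End LevelStructures.

(** * Free action of the level group *)

Lemma level_coset_mul (C : fieldType) s n (G : set 'M[C]_n)
    (g h : level_tuple C s n) :
  mx_subgroup G -> (forall j, G (h j)) ->
  level_mul (level_coset G g) (level_coset G h) =
  level_coset G (fun j => g j *m h j).
Proof.
move=> sG Gh; have [_ Z1 ZM _] := mx_center_subgroup sG.
apply/seteqP; split=> x.
  case=> _ [z Zz <-] [_ [w Zw <-] <-]; exists (z *m w); first exact: ZM.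
  have [_ zC] := Zz.
  by apply/funext => j; rewrite -!mulmxA (mulmxA z) (zC _ (Gh j)) !mulmxA.
case=> z Zz <-; exists g.
  by exists 1%:M => //; apply/funext => j; rewrite mulmx1.
by exists (fun j => h j *m z); [exists z | apply/funext => j; rewrite mulmxA].
Qed.

Lemma level_coset_center (C : fieldType) s n (G : set 'M[C]_n) z :
  mx_subgroup G -> mx_center G z ->
  level_coset G (fun _ : 'I_s => z) = @level_one C s n G.
Proof.
move=> sG Zz; have [uZ _ ZM ZV] := mx_center_subgroup sG.
apply/seteqP; split=> x [w Zw <-].
  by exists (z *m w); [apply: ZM | apply/funext => j; rewrite mul1mx].
exists (invmx z *m w); first by apply: ZM => //; apply: ZV.
by apply/funext => j; rewrite mulKVmx ?mul1mx //; apply: uZ.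
Qed.

Theorem theorem5p14 (R : realType) (X : projvar R[i])
  (hX : smooth_projective_curve X)
  (loc : forall p : curve_point X, {rmorphism funfield X -> laurent R[i]})
  (hloc : forall p : curve_point X, formal_coordinate p (loc p))
  (s : nat) (D : 'I_s -> curve_point X) (hD : injective D)
  (n : nat) (G T : set 'M[R[i]]_n)
  (hG : reductive G) (hGc : connected_group G) (hT : maximal_torus G T)
  (theta : 'I_s -> weight R[i] n)
  (htheta : forall j : 'I_s, rational_weight T (theta j))
  (res : 'I_s -> 'M[laurent R[i]]_n -> 'M[R[i]]_n)
  (hres : forall j : 'I_s, levi_residue G T (theta j) (res j)) :
  acts_freely (level_group G T theta) (@level_one R[i] s n G)
    (@level_mul R[i] s n)
    (@level_act R[i] X s n G T theta res)
    (moduli_rs loc D G T theta).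
Proof.
have sG : mx_subgroup G by case: hGc => -[].
have TG : T `<=` G by case: hT.
have locC p c : loc p (fconst X c) = laurent_const c by case: (hloc p).
pose L j := levi G T (theta j).
have Lsub j : L j `<=` G := levi_sub sG TG (j := j).
have actE A g (pA : level_pair D G T theta A)
    (rA : regularly_stable loc G T theta A.1) (Lg : forall j, L j (g j)) :=
  level_act_coset locC hD sG TG hres pA rA.2 Lg.
split.
- move=> _ _ [g Lg <-] [A [pA rA] <-]; rewrite actE //.
  exists (level_act1 G T theta res g A) => //; split=> //.
  exact: level_act1_pair.
- move=> _ [A [pA rA] <-]; rewrite actE ?(level_act1_1 hD sG TG hres pA) //.
  by move=> j; case: (levi_subgroup theta sG TG j).
- move=> _ _ _ [g Lg <-] [h Lh <-] [A [pA rA] <-].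
  have Gh j : G (h j) by apply: (Lsub j); apply: Lh.
  rewrite level_coset_mul //.
  rewrite !actE // ?(level_act1M sG TG hres) //; first exact: level_act1_pair.
  by move=> j; have [_ _ LM _] := levi_subgroup theta sG TG j; apply: LM.
- move=> _ _ [g Lg <-] [A [pA rA] <-]; rewrite actE // => gA.
  have [_ Aeq] :
      level_class loc D G T theta A (level_act1 G T theta res g A).
    rewrite -gA; split; first exact: level_act1_pair.
    apply: level_equiv_refl => //; exact: rA.2.
  have [z Zz ->] := level_stabilizer_central locC hD sG TG hres pA rA.2 Lg Aeq.
  exact: level_coset_center.
Qed.
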